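(* Let $T=(V,E)$ be a decision tree with root $r$ computing a function $f:\mathcal{D}\to\Sigma_O$, $\mathcal{D}\subseteq\Sigma_I^n$, and let $w$ be a weighting scheme for $T$. Then $f$ can be computed with bounded error by a quantum query algorithm making $O(w_r)$ queries to $x$. Consequently, $\mathsf{Q}(f)\in O(\mathsf{WDT}(f))$, where $\mathsf{WDT}(f)$ is the minimum of $\mathsf{WDT}(T)$ over decision trees $T$ computing $f$.
   Context: A decision tree over finite alphabets $\Sigma_I,\Sigma_O$ is a finite rooted tree in which each internal node $v$ is labeled with an index $i_v\in[n]$, the edges from $v$ to its children $C_v$ are labeled with pairwise distinct symbols of $\Sigma_I$, and each leaf is labeled with an element of $\Sigma_O$; it computes $f$ if for every $x\in\mathcal{D}$, starting from the root and repeatedly following the edge labeled $x_{i_v}$, one reaches a leaf labeled $f(x)$. A weighting scheme for $T$ is $w:V\to\mathbb{R}_{\ge0}$ such that $w_v=0$ for all leaves and, for every internal node $v$ with children $C_v$, there exist positive semidefinite $X,Y\in\mathbb{C}^{C_v\times C_v}$ with $X[c_1,c_2]-Y[c_1,c_2]=1$ for all distinct $c_1,c_2\in C_v$ and $w_v-w_c\ge X[c,c]+Y[c,c]$ for all $c\in C_v$. $\mathsf{WDT}(T)$ is the minimum of $w_r$ over weighting schemes. $\mathsf{Q}(f)$ is the bounded-error quantum query complexity of $f$ with standard quantum query access to $x$ (e.g. $|i\rangle|b\rangle\mapsto|i\rangle|b+x_i\rangle$ with $\Sigma_I$ identified with a cyclic group). *)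

(* Defs.v *)
(* (+ MathComp-Analysis for [inf], real_closed for complex numbers). *)
From HB Require Import structures.
From mathcomp Require Import all_boot all_order all_algebra.
From mathcomp Require Import complex.
From mathcomp Require Import boolp classical_sets reals Rstruct.

Set Implicit Arguments.
Unset Strict Implicit.
Unset Printing Implicit Defensive.

Import Order.TTheory GRing.Theory Num.Theory.
Local Open Scope ring_scope.

(* Real numbers: Stdlib's R (a realType via Rstruct); complex numbers R[i]. *)
Notation Real := Rdefinitions.R.
Notation Cplx := (Rdefinitions.R)[i].

(* Decision trees over finite alphabets SI (input) and SO (output).  *)
(* An internal node [Node i ch] queries x_i; its children are listed  *)
(* in [ch] together with the edge labels (symbols of SI).             *)
Inductive dtree (n : nat) (SI SO : finType) : Type :=
| Leaf : SO -> dtree n SI SO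
| Node : 'I_n -> seq (SI * dtree n SI SO) -> dtree n SI SO.

Arguments Leaf {n SI SO}.
Arguments Node {n SI SO}.

(* c-th child (c : 'I_(size ch)) *)
Definition child n (SI SO : finType) (ch : seq (SI * dtree n SI SO))
  (c : 'I_(size ch)) : dtree n SI SO := (tnth (in_tuple ch) c).2.

(* Well-formedness: edge labels out of every node are pairwise distinct. *)
Inductive dt_wf n (SI SO : finType) : dtree n SI SO -> Prop :=
| wf_leaf o : dt_wf (Leaf o)
| wf_node i ch : uniq (map fst ch) ->
    (forall c : 'I_(size ch), dt_wf (child c)) -> dt_wf (Node i ch).

(* Running the tree on input x; [None] if the followed edge does not exist. *)
Fixpoint dt_eval n (SI SO : finType) (t : dtree n SI SO) (x : {ffun 'I_n -> SI})
  : option SO :=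
  match t with
  | Leaf o => Some o
  | Node i ch =>
      (fix go (l : seq (SI * dtree n SI SO)) : option SO :=
         match l with
         | [::] => None
         | (a, t') :: l' => if a == x i then dt_eval t' x else go l'
         end) ch
  end.

(* T computes f on the domain D. *)
Definition dt_computes n (SI SO : finType) (t : dtree n SI SO)
  (D : {set {ffun 'I_n -> SI}}) (f : {ffun 'I_n -> SI} -> SO) : Prop :=
  forall x, x \in D -> dt_eval t x = Some (f x).

(* Weighting schemes.                                                 *)
(* Nodes are addressed by paths (seq of child indices, [::] = root);  *)
(* w : seq nat -> R gives the weight of each node.                    *)
Local Open Scope sesquilinear_scope.

(* positive semidefinite complex matrix *)
Definition psdmx (k : nat) (A : 'M[Cplx]_k) : Prop :=
  A \is hermsymmx /\ forall v : 'rV[Cplx]_k, 0 <= (v *m A *m v ^t*) 0 0.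

Inductive is_wscheme n (SI SO : finType) : dtree n SI SO -> (seq nat -> Real) -> Prop :=
| ws_leaf o (w : seq nat -> Real) : w [::] = 0 -> is_wscheme (Leaf o) w
| ws_node i ch (w : seq nat -> Real) :
    0 <= w [::] ->
    (exists X Y : 'M[Cplx]_(size ch),
        [/\ psdmx X, psdmx Y,
            (forall c1 c2 : 'I_(size ch), c1 != c2 -> X c1 c2 - Y c1 c2 = 1) &
            (forall c : 'I_(size ch),
                X c c + Y c c <= ((w [::] - w [:: val c]) : Real)%:C%C)]) ->
    (forall c : 'I_(size ch), is_wscheme (child c) (fun p => w (val c :: p))) ->
    is_wscheme (Node i ch) w.

(* WDT(T) = min (here: inf) of w_r over weighting schemes of T *)
Definition WDT_tree n (SI SO : finType) (t : dtree n SI SO) : Real :=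
  inf [set w [::] | w in [set w | is_wscheme t w]].

(* WDT(f) = min over decision trees T computing f of WDT(T) *)
Definition WDT n (SI SO : finType) (D : {set {ffun 'I_n -> SI}})
  (f : {ffun 'I_n -> SI} -> SO) : Real :=
  inf [set WDT_tree t | t in [set t : dtree n SI SO | dt_wf t /\ dt_computes t D f]].

(* Quantum query algorithms (standard oracle |i,b,z> -> |i,b+x_i,z>,  *)
(* SI identified with the cyclic group Z/|SI| via enum_rank).         *)
(* Basis states: (i, b, z) with i : 'I_n, b : 'I_#|SI|, z : 'I_k      *)
(* (workspace).  States are row vectors, gates act on the right.      *)
Definition basis_t (n m k : nat) := ('I_n * 'I_m * 'I_k)%type.
Definition qdim (n m k : nat) := #|{: basis_t n m k}|.

Lemma ord_pos_subproof m (b : 'I_m) : (0 < m)%N.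
Proof. by apply: leq_ltn_trans (ltn_ord b). Qed.

Definition addI m (a b : 'I_m) : 'I_m :=
  Ordinal (ltn_pmod (a + b) (ord_pos_subproof a)).

Definition oracle_step n (SI : finType) k (x : {ffun 'I_n -> SI})
  (s : basis_t n #|SI| k) : basis_t n #|SI| k :=
  let: (i, b, z) := s in (i, addI b (enum_rank (x i)), z).

Definition oracle n (SI : finType) k (x : {ffun 'I_n -> SI})
  : 'M[Cplx]_(qdim n #|SI| k) :=
  \matrix_(s, t) (oracle_step x (enum_val s) == enum_val t)%:R.

(* state after U_0, O_x, U_1, ..., O_x, U_j (j queries) *)
Fixpoint qrun n (SI : finType) k (x : {ffun 'I_n -> SI})
  (psi0 : 'rV[Cplx]_(qdim n #|SI| k)) (U : nat -> 'M[Cplx]_(qdim n #|SI| k))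
  (j : nat) : 'rV[Cplx]_(qdim n #|SI| k) :=
  match j with
  | 0 => psi0 *m U 0%N
  | j'.+1 => qrun x psi0 U j' *m oracle k x *m U j
  end.

(* There is a quantum query algorithm with workspace dimension k making
   exactly T queries that computes f on D with bounded error (>= 2/3):
   fixed unit initial state psi0, unitaries U_0..U_T, then a measurement in
   the computational basis followed by classical post-processing [out]. *)
Definition qcomputes_bounded n (SI SO : finType) (D : {set {ffun 'I_n -> SI}})
  (f : {ffun 'I_n -> SI} -> SO) (k T : nat) : Prop :=
  exists (psi0 : 'rV[Cplx]_(qdim n #|SI| k))
         (U : nat -> 'M[Cplx]_(qdim n #|SI| k))
         (out : 'I_(qdim n #|SI| k) -> SO),
    [/\ \sum_s `|psi0 0 s| ^+ 2 = 1,
        (forall j, (j <= T)%N -> U j \is unitarymx) &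
        forall x, x \in D ->
          2%:R / 3%:R <= \sum_(s | out s == f x) `|qrun x psi0 U T 0 s| ^+ 2].

(* Q(f): bounded-error quantum query complexity *)
Definition Qcomplexity n (SI SO : finType) (D : {set {ffun 'I_n -> SI}})
  (f : {ffun 'I_n -> SI} -> SO) : Real :=
  inf [set (T%:R : Real) | T in [set T : nat | exists k, qcomputes_bounded D f k T]].

(* Main.v *)
(* Writing the matrices of each node as Gram matrices of vectors alpha_c and beta_c, let
   v_x be the direct sum over the nodes on the path of x of |i_v, b0> (x) alpha_c and
   |i_v, b0 - x_i> (x) beta_c. If O_x is the oracle, then
     <v_x, v_y> - <O_x v_x, O_y v_y> = [x and y reach different leaves], |v_x|^2 <= w_r.
   Equality of Gram matrices then yields one unitary, independent of x, which maps
   xi (+) O_x v_x to |leaf x> (+) v_x: with v_x as a catalyst, one query computes the leaf.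
   Spreading the input over N registers, amplitude 1 / sqrt N each, and reusing the
   catalyst for all of them makes the catalyst's share of the norm so small that it may be
   omitted: the failure probability is at most 4 w_r / N. *)
Require Import Defs.
From HB Require Import structures.
From mathcomp Require Import all_boot all_order all_algebra.
From mathcomp Require Import complex.
From mathcomp Require Import boolp classical_sets reals Rstruct.
From mathcomp Require Import ring lra.
Set Implicit Arguments.
Unset Strict Implicit.
Unset Printing Implicit Defensive.
Import Order.TTheory GRing.Theory Num.Theory.
Local Open Scope ring_scope.

(** * Unitaries obtained from equal Gram matrices *)

Section UnitaryExtension.
Local Open Scope sesquilinear_scope.
Variables (C : numClosedFieldType) (q : nat).
Implicit Types a b c : 'rV[C]_q.

Lemma unitarymx1 : (1%:M : 'M[C]_q) \is unitarymx.
Proof. by apply/unitarymxP; rewrite trmx1 map_mx1 mulmx1. Qed.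

(* A complex Householder reflection: with d = a - b, the map 1 - g^-1 d^* d is
   unitary exactly when g + g^* = |d|^2, which holds for g = <a, d>. *)
Lemma unitary_move a b : a *m a ^t* = b *m b ^t* ->
  exists2 U : 'M[C]_q, U \is unitarymx &
    a *m U = b /\ forall c, c *m a ^t* = c *m b ^t* -> c *m U = c.
Proof.
move=> eqab; have [->|neq_ab] := eqVneq a b.
  by exists 1%:M; rewrite ?unitarymx1 // mulmx1; split=> // c _; rewrite mulmx1.
pose d := a - b; pose g := (a *m d ^t*) 0 0.
have adE : a *m d ^t* = g%:M by rewrite [LHS]mx11_scalar.
have daE : d *m a ^t* = (g^*)%:M.
  have -> : d *m a ^t* = (a *m d ^t*) ^t*.
    by rewrite trmx_mul map_mxM /= map_trmx trmxK -map_mx_comp (map_mx_id (@conjCK _)).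
  by rewrite adE; apply/matrixP => i j; rewrite !mxE !ord1 eqxx.
have dtE : d ^t* = a ^t* - b ^t* by rewrite linearB /= map_mxB.
(* Since a and b have equal norm, -<b, d> equals <d, a>, the conjugate of g. *)
have ddE : d *m d ^t* = (g + g^*)%:M.
  rewrite [RHS](raddfD (@scalar_mx _ 1)) /= -adE -daE {1}/d mulmxBl; congr (_ + _).
  by rewrite dtE mulmxBr opprB -eqab /d mulmxBl.
have g0 : g != 0.
  apply/eqP => g0; move/eqP: neq_ab; apply; apply/eqP; rewrite -subr_eq0 -/d.
  apply/eqP/rowP => j; rewrite mxE; apply/eqP.
  have /matrixP/(_ 0 0) := ddE; rewrite !mxE g0 conjC0 addr0 mul0rn => /eqP.
  rewrite psumr_eq0 => [/allP /(_ j)|k _]; last by rewrite !mxE -normCK exprn_ge0.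
  by rewrite mem_index_enum !mxE -normCK sqrf_eq0 normr_eq0; apply.
exists (1%:M - g^-1 *: (d ^t* *m d)); last first.
  split=> [|c cab].
    rewrite mulmxBr mulmx1 -scalemxAr mulmxA adE mul_scalar_mx scalerA mulVf //.
    by rewrite scale1r /d opprB addrC subrK.
  have cd0 : c *m d ^t* = 0 by rewrite dtE mulmxBr cab subrr.
  by rewrite mulmxBr mulmx1 -scalemxAr mulmxA cd0 mul0mx scaler0 subr0.
apply/unitarymxP.
have -> : (1%:M - g^-1 *: (d ^t* *m d)) ^t* = 1%:M - (g^*)^-1 *: (d ^t* *m d).
  rewrite linearB /= map_mxB trmx1 map_mx1 linearZ /= map_mxZ fmorphV /=.
  by rewrite trmx_mul map_mxM map_trmx trmxK -map_mx_comp (map_mx_id (@conjCK _)).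
have gc0 : g^* != 0 by rewrite conjC_eq0.
rewrite mulmxBr mulmx1 mulmxBl mul1mx -scalemxAl -scalemxAr.
rewrite mulmxA -(mulmxA (d ^t*) d) ddE mul_mx_scalar -scalemxAl !scalerA.
rewrite -addrA -opprD -scalerBl -scalerDl.
suff -> : g^-1 + ((g^*)^-1 - g^-1 * ((g^*)^-1 * (g + g^*))) = 0.
  by rewrite scale0r subr0.
by field; apply/andP.
Qed.

(** Induction on the list: a reflection sends the image of the new vector to its target. It fixes
    every target reached before, because their inner products with these two vectors agree. *)
Lemma unitary_of_gram (I : eqType) (s : seq I) (a b : I -> 'rV[C]_q) :
    {in s &, forall x y, a x *m (a y) ^t* = b x *m (b y) ^t*} ->
  exists2 U : 'M[C]_q, U \is unitarymx & {in s, forall x, a x *m U = b x}.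
Proof.
elim: s => [|z s IHs] gram; first by exists 1%:M; rewrite ?unitarymx1.
have [x y xs ys|U Uu aU] := IHs; first by apply: gram; rewrite inE ?xs ?ys orbT.
have [|V Vu [zV fixV]] := @unitary_move (a z *m U) (b z).
  by rewrite -gram ?mem_head // trmx_mul map_mxM mulmxA mulmxtVK //.
exists (U *m V) => [|x]; first exact: mul_unitarymx.
rewrite inE mulmxA => /orP[/eqP->//|xs]; rewrite aU // fixV //.
rewrite -aU // trmx_mul map_mxM mulmxA mulmxtVK // aU //.
by rewrite gram ?mem_head // inE xs orbT.
Qed.

End UnitaryExtension.

(** * Gram vectors of positive semidefinite matrices *)

Section PsdFactor.
Local Open Scope sesquilinear_scope.

(** Spectral theorem: testing positivity on the eigenvectors shows that the eigenvalues are
    nonnegative, so they have square roots. The rows of [A] are the Gram vectors of [X]. *)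
Lemma psdmx_factor k (X : 'M[Cplx]_k) : psdmx X -> exists A : 'M_k, X = A *m A ^t*.
Proof.
move=> [Xh Xpos]; set P := spectralmx X; set D := spectral_diag X.
have Pu : P \is unitarymx := spectral_unitarymx X.
have XE : X = P ^t* *m diag_mx D *m P.
  by rewrite -invmx_unitary //; apply/orthomx_spectralP/hermitian_normalmx.
have D_ge0 j : 0 <= D 0 j.
  have := Xpos (row j P); rewrite XE !mulmxA.
  rewrite -row_mul (unitarymxP Pu) row1 -rowE.
  have -> : (row j P) ^t* = P ^t* *m (delta_mx 0 j) ^t*.
    by rewrite -map_mxM -trmx_mul -rowE.
  rewrite mulmxA mulmxtVK // !mxE (bigD1 j) //= big1 => [|i /negPf ij].
    by rewrite !mxE !eqxx !mulr1n conjC1 mulr1 addr0.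
  by rewrite !mxE ij conjC0 mulr0.
exists (P ^t* *m diag_mx (map_mx sqrtC D)).
rewrite trmx_mul map_mxM map_trmx trmxK -map_mx_comp (map_mx_id (@conjCK _)).
rewrite {1}XE !mulmxA; congr (_ *m _); rewrite -mulmxA; congr (_ *m _).
rewrite tr_diag_mx map_diag_mx mulmx_diag; congr diag_mx.
apply/rowP => j; rewrite !mxE /= geC0_conj ?sqrtC_ge0 //.
by rewrite -expr2 sqrtCK.
Qed.

Lemma psdmx_const1 k : psdmx (const_mx 1 : 'M[Cplx]_k).
Proof.
split=> [|v].
  by apply/is_hermitianmxP/matrixP => i j; rewrite !mxE expr0 mul1r conjC1.
have -> : const_mx 1 = (const_mx 1 : 'cV[Cplx]_k) *m (const_mx 1 : 'cV_k) ^t*.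
  by apply/matrixP => i j; rewrite !mxE big_ord1 !mxE conjC1 mulr1.
rewrite mulmxA -mulmxA -map_mxM -trmx_mul !mxE big_ord1 !mxE.
by rewrite -normCK exprn_ge0.
Qed.

Lemma psdmx0 k : psdmx (0 : 'M[Cplx]_k).
Proof.
split=> [|v]; last by rewrite mulmx0 mul0mx mxE.
by apply/is_hermitianmxP/matrixP => i j; rewrite !mxE conjC0 mulr0.
Qed.

End PsdFactor.

(** * Inner products of vectors indexed by finite types *)

Section Dot.
Variable C : numClosedFieldType.

Definition dot (S : finType) (u v : S -> C) : C := \sum_s u s * (v s)^*.

Lemma dotxx (S : finType) (u : S -> C) : dot u u = \sum_s `|u s| ^+ 2.
Proof. by apply: eq_bigr => s _; rewrite normCK. Qed.

Lemma dotxx_ge0 (S : finType) (u : S -> C) : 0 <= dot u u.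
Proof. by rewrite dotxx sumr_ge0 // => s _; rewrite exprn_ge0. Qed.

Lemma eq_dot (S : finType) (u u' v v' : S -> C) :
  u =1 u' -> v =1 v' -> dot u v = dot u' v'.
Proof. by move=> eu ev; apply: eq_bigr => s _; rewrite eu ev. Qed.

Lemma dotZ (S : finType) (a b : C) (u v : S -> C) :
  dot (fun s => a * u s) (fun s => b * v s) = a * b^* * dot u v.
Proof. by rewrite /dot mulr_sumr; apply: eq_bigr => s _; rewrite rmorphM /= mulrACA. Qed.

Lemma dot_sum (A Z1 Z2 : finType) (u v : A * (Z1 + Z2) -> C) :
  dot u v = dot (fun s : A * Z1 => u (s.1, inl s.2)) (fun s => v (s.1, inl s.2))
          + dot (fun s : A * Z2 => u (s.1, inr s.2)) (fun s => v (s.1, inr s.2)).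
Proof.
pose F a z := u (a, z) * (v (a, z))^*.
rewrite /dot -(pair_bigA _ (fun a z => F a (inl z))) -(pair_bigA _ (fun a z => F a (inr z))) /=.
rewrite -big_split /= (eq_bigr (fun s => F s.1 s.2)) => [|[a z] _] //.
by rewrite -(pair_bigA _ F) /=; apply: eq_bigr => a _; rewrite big_sumType.
Qed.

Lemma dot_tensor (A Z : finType) (g h : A -> C) (u v : Z -> C) :
  dot (fun s : A * Z => g s.1 * u s.2) (fun s => h s.1 * v s.2) = dot g h * dot u v.
Proof.
rewrite /dot -(pair_bigA _ (fun a z => g a * u z * (h a * v z)^*)) /= mulr_suml.
by apply: eq_bigr => a _; rewrite mulr_sumr; apply: eq_bigr => z _; rewrite rmorphM /= mulrACA.
Qed.

Lemma dot_delta (A : finType) (p p' : A) :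
  dot (fun s => (s == p)%:R) (fun s => (s == p')%:R) = (p == p')%:R.
Proof.
rewrite /dot (bigD1 p) //= eqxx mul1r big1 ?addr0 => [|s /negPf->]; last by rewrite mul0r.
by rewrite rmorph_nat.
Qed.

Lemma dot_delta_tensor (A Z : finType) (p p' : A) (u v : Z -> C) :
  dot (fun s : A * Z => (s.1 == p)%:R * u s.2) (fun s => (s.1 == p')%:R * v s.2)
  = (p == p')%:R * dot u v.
Proof. by rewrite (dot_tensor (fun a => (a == p)%:R) (fun a => (a == p')%:R)) dot_delta. Qed.

Lemma dot_reindex (S : finType) (h : S -> S) (u v : S -> C) :
  injective h -> dot (u \o h) (v \o h) = dot u v.
Proof. by move=> hI; rewrite /dot [RHS](reindex_inj hI). Qed.

(** The left side is twice the real part of <u, v>; each term is bounded by 2|a||b| <= |a|^2 +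
    |b|^2. *)
Lemma re_dot_le (S : finType) (u v : S -> C) :
  `|dot u v + dot v u| <= dot u u + dot v v.
Proof.
have dE : dot u v + dot v u = \sum_s (u s * (v s)^* + v s * (u s)^*).
  by rewrite -big_split.
rewrite dE (le_trans (ler_norm_sum _ _ _)) // !dotxx -big_split /=.
apply: ler_sum => s _; rewrite (le_trans (ler_normD _ _)) // !normrM !norm_conjC.
rewrite [X in _ + X]mulrC -mulr2n -subr_ge0.
have -> : `|u s| ^+ 2 + `|v s| ^+ 2 - (`|u s| * `|v s|) *+ 2 = (`|u s| - `|v s|) ^+ 2.
  by rewrite sqrrB addrAC.
by rewrite -realEsqr rpredB // normr_real.
Qed.

Lemma sqr_norm_sub_le (a b : C) :
  `|a - b| ^+ 2 <= (`|a| ^+ 2 + `|b| ^+ 2) *+ 2.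
Proof.
apply: (@le_trans _ _ ((`|a| + `|b|) ^+ 2)).
  by rewrite lerXn2r ?nnegrE ?addr_ge0 ?ler_normB.
rewrite -subr_ge0.
have -> : (`|a| ^+ 2 + `|b| ^+ 2) *+ 2 - (`|a| + `|b|) ^+ 2 = (`|a| - `|b|) ^+ 2 by ring.
by rewrite -realEsqr rpredB // normr_real.
Qed.

End Dot.

(** * Cyclic addition, the query permutation, and operations on catalysts *)

Lemma addIC m (a b : 'I_m) : addI a b = addI b a.
Proof. by apply: val_inj; rewrite /= addnC. Qed.

Lemma addI_inj m (a : 'I_m) : injective (fun b => addI b a).
Proof.
move=> b c /(congr1 val) /= /eqP; rewrite eqn_modDr => /eqP.
by rewrite !modn_small // => /val_inj.
Qed.

Lemma addIl_inj m (a : 'I_m) : injective (@addI m a).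
Proof. by move=> b c; rewrite !(addIC a) => /addI_inj. Qed.

Section Catalyst.
Variables (n : nat) (SI : finType) (C : numClosedFieldType).
Local Notation X := {ffun 'I_n -> SI}.

Definition query (Z : Type) (x : X) (s : 'I_n * 'I_#|SI| * Z) : 'I_n * 'I_#|SI| * Z :=
  ((s.1.1, addI s.1.2 (enum_rank (x s.1.1))), s.2).

Lemma query_inj (Z : Type) (x : X) : injective (@query Z x).
Proof.
move=> [[i b] z] [[i' b'] z'] [<- eb <-].
by have -> : b = b' by apply: (@addI_inj _ (enum_rank (x i))); apply: val_inj.
Qed.

(* [u x] is the image of [v x] under the oracle. In the language of transducers,
   [v x] is a catalyst that pays for the change of Gram matrix [kap]. *)
Definition catalyst (kap : X -> X -> C) (cost : X -> C) : Prop :=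
  exists (Z : finType) (v u : X -> 'I_n * 'I_#|SI| * Z -> C),
  [/\ forall x, v x =1 u x \o query x,
      forall x y, dot (v x) (v y) - dot (u x) (u y) = kap x y &
      forall x, dot (v x) (v x) = cost x].

Lemma eq_catalyst kap kap' cost cost' :
  kap =2 kap' -> cost =1 cost' -> catalyst kap cost -> catalyst kap' cost'.
Proof.
move=> ek ec [Z [v [u [vu kv cv]]]]; exists Z, v, u.
by split=> // [x y|x]; rewrite -?ek -?ec.
Qed.

Lemma catalyst0 : catalyst (fun _ _ => 0) (fun _ => 0).
Proof.
exists unit, (fun _ _ => 0), (fun _ _ => 0).
have d0 : dot (fun _ : 'I_n * 'I_#|SI| * unit => 0 : C) (fun _ => 0) = 0.
  by rewrite /dot big1 // => s _; rewrite mul0r.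
by split=> [x s|x y|x]; rewrite ?d0 ?subr0.
Qed.

(** Direct sum of the workspaces over a shared query register: inner products and norms add. *)
Lemma catalystD kap1 kap2 cost1 cost2 :
  catalyst kap1 cost1 -> catalyst kap2 cost2 ->
  catalyst (fun x y => kap1 x y + kap2 x y) (fun x => cost1 x + cost2 x).
Proof.
move=> [Z1 [v1 [u1 [vu1 k1 c1]]]] [Z2 [v2 [u2 [vu2 k2 c2]]]].
pose glue (w1 : X -> 'I_n * 'I_#|SI| * Z1 -> C) (w2 : X -> 'I_n * 'I_#|SI| * Z2 -> C)
  (x : X) (s : 'I_n * 'I_#|SI| * (Z1 + Z2)) :=
  match s.2 with inl z => w1 x (s.1, z) | inr z => w2 x (s.1, z) end.
have dg w1 w2 x y :
    dot (glue w1 w2 x) (glue w1 w2 y) = dot (w1 x) (w1 y) + dot (w2 x) (w2 y).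
  by rewrite dot_sum; congr (_ + _); apply: eq_dot => -[].
exists (Z1 + Z2)%type, (glue v1 v2), (glue u1 u2).
split=> [x [p [z|z]]|x y|x]; rewrite ?dg -?k1 -?k2 -?c1 -?c2 //.
- by rewrite /glue /= vu1.
- by rewrite /glue /= vu2.
by rewrite opprD addrACA.
Qed.

Lemma catalyst_sum (I : Type) (r : seq I) (kap : I -> X -> X -> C) (cost : I -> X -> C) :
  (forall c, catalyst (kap c) (cost c)) ->
  catalyst (fun x y => \sum_(c <- r) kap c x y) (fun x => \sum_(c <- r) cost c x).
Proof.
move=> cat; elim: r => [|c r IHr].
  by apply: eq_catalyst catalyst0 => [x y|x]; rewrite big_nil.
by apply: eq_catalyst (catalystD (cat c) IHr) => [x y|x]; rewrite big_cons.
Qed.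

Lemma catalyst_restrict (P : pred X) kap cost : catalyst kap cost ->
  catalyst (fun x y => (P x && P y)%:R * kap x y) (fun x => (P x)%:R * cost x).
Proof.
move=> [Z [v [u [vu k c]]]].
exists Z, (fun x s => (P x)%:R * v x s), (fun x s => (P x)%:R * u x s).
split=> [x s|x y|x]; rewrite ?dotZ /= ?vu // -?mulrBr ?k ?c rmorph_nat -natrM mulnb //.
by rewrite andbb.
Qed.

(** Here v_x is |i, b0> (x) a_x. The query writes x_i into the register, which makes the vectors of
    x and y orthogonal exactly when x_i and y_i differ. *)
Lemma catalyst_query (b0 : 'I_#|SI|) (i : 'I_n) (Z : finType) (a : X -> Z -> C) :
  catalyst (fun x y => (x i != y i)%:R * dot (a x) (a y)) (fun x => dot (a x) (a x)).
Proof.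
exists Z, (fun x s => (s.1 == (i, b0))%:R * a x s.2),
  (fun (x : X) s => (s.1 == (i, addI b0 (enum_rank (x i))))%:R * a x s.2).
split=> [x [[j b] z]|x y|x] /=.
- congr (_%:R * _); rewrite !xpair_eqE; case: eqVneq => //= ->.
  by rewrite (inj_eq (@addI_inj _ _)).
- rewrite !dot_delta_tensor !xpair_eqE !eqxx /= -mulrBl; congr (_ * _).
  rewrite (inj_eq (@addIl_inj _ _)) (inj_eq enum_rank_inj).
  by case: eqP; rewrite ?subrr ?subr0.
by rewrite dot_delta_tensor eqxx mul1r.
Qed.

(** The reverse of the previous construction: the register starts at b0 - x_i, which is [pre x], and
    the query brings it to b0 for all inputs, so that inner products appear instead of vanishing. *)
Lemma catalyst_queryN (b0 : 'I_#|SI|) (i : 'I_n) (Z : finType) (a : X -> Z -> C) :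
  catalyst (fun x y => - ((x i != y i)%:R * dot (a x) (a y))) (fun x => dot (a x) (a x)).
Proof.
pose pre (x : X) := invF (@addI_inj _ (enum_rank (x i))) b0.
have addpre (x : X) : addI (pre x) (enum_rank (x i)) = b0 := f_invF (@addI_inj _ (enum_rank (x i))) b0.
have preE (x : X) b : (b == pre x) = (addI b (enum_rank (x i)) == b0).
  by rewrite -[b0 in RHS](addpre x) (inj_eq (@addI_inj _ _)).
exists Z, (fun x s => (s.1 == (i, pre x))%:R * a x s.2),
  (fun x s => (s.1 == (i, b0))%:R * a x s.2).
split=> [x [[j b] z]|x y|x] /=.
- by congr (_%:R * _); rewrite !xpair_eqE; case: eqVneq => //= ->; rewrite preE.
- rewrite !dot_delta_tensor !xpair_eqE !eqxx /= -mulrBl -mulNr; congr (_ * _).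
  have -> : (pre x == pre y) = (x i == y i).
    rewrite preE -[b0 in LHS](addpre x).
    by rewrite (inj_eq (@addIl_inj _ _)) (inj_eq enum_rank_inj) eq_sym.
  by case: eqP; rewrite ?subrr ?sub0r ?oppr0.
by rewrite dot_delta_tensor eqxx mul1r.
Qed.

End Catalyst.

(** * The catalyst of a weighted decision tree *)

Section TreeCatalyst.
Local Open Scope sesquilinear_scope.
Variables (n : nat) (SI SO : finType).
Local Notation X := {ffun 'I_n -> SI}.
Implicit Types (t : dtree n SI SO) (ch : seq (SI * dtree n SI SO)) (w : seq nat -> Rdefinitions.R).

(** [find] returns [size ch] when no edge carries x_i; [insub] turns this into [None]. *)
Definition branch (i : 'I_n) ch (x : X) : option 'I_(size ch) :=
  insub (find (fun p => p.1 == x i) ch).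

Lemma dt_eval_Node i ch x :
  dt_eval (Node i ch) x = if branch i ch x is Some c then dt_eval (child c) x else None.
Proof.
pose d := head (x i, Node i ch) ch.
have -> : dt_eval (Node i ch) x =
    if (find (fun p => p.1 == x i) ch < size ch)%N
    then dt_eval (nth d ch (find (fun p => p.1 == x i) ch)).2 x else None.
  rewrite /=; move: d => d; elim: ch => //= [[a t] l IHl] /=.
  by case: eqP => //= _; rewrite ltnS.
rewrite /branch; case: insubP => [c -> cE|/negPf-> //].
by rewrite /child (tnth_nth d) /= -cE.
Qed.

Lemma branch_eq i ch x y c c' :
  branch i ch x = Some c -> branch i ch y = Some c' -> (x i == y i) = (c == c').
Proof.
rewrite /branch; case: insubP => // c1 xlt cE [<-]; case: insubP => // c2 ylt cE' [<-].
apply/eqP/eqP => [exy|ec]; first by apply: val_inj; rewrite cE cE' exy.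
pose d := tnth (in_tuple ch) c1.
have /(nth_find d)/eqP <- : has (fun p => p.1 == x i) ch by rewrite has_find.
have /(nth_find d)/eqP <- : has (fun p => p.1 == y i) ch by rewrite has_find.
by rewrite -cE -cE' ec.
Qed.

Lemma wscheme_ge0 t w : is_wscheme t w -> 0 <= w [::].
Proof. by case=> [o w' ->|]. Qed.

(* Two inputs part at exactly one node, where the condition X - Y = 1 makes the
   increments sum up to 1; along a path the costs telescope to w_r. *)
Lemma tree_catalyst (b0 : 'I_#|SI|) t w : is_wscheme t w ->
  exists (leaf : X -> seq nat) kap cost,
  [/\ catalyst kap cost,
      forall x y, dt_eval t x -> dt_eval t y ->
        leaf x = leaf y -> dt_eval t x = dt_eval t y,
      forall x y, dt_eval t x -> dt_eval t y -> kap x y = (leaf x != leaf y)%:R &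
      forall x, dt_eval t x -> cost x <= (w [::])%:C%C].
Proof.
elim=> {t w} [o w w0|i ch w w0 [A [B [Apsd Bpsd AB ABw]]] ws IH].
  exists (fun=> [::]), (fun _ _ => 0), (fun=> 0); split=> //; first exact: catalyst0.
  by move=> x _; rewrite w0.
have {IH} /choice[leaf] := IH; case/choice=> kap /choice[cost] IH.
have [[P PE] [Q QE]] := (psdmx_factor Apsd, psdmx_factor Bpsd).
(* The Gram vector of the child taken by x, or zero if x has no edge to follow. *)
pose brow (M : 'M[Cplx]_(size ch)) (x : X) (j : 'I_(size ch)) : Cplx :=
  if branch i ch x is Some c then M c j else 0.
have dot_brow M x y c c' : branch i ch x = Some c -> branch i ch y = Some c' ->
    dot (brow M x) (brow M y) = (M *m M ^t*) c c'.
  by move=> xc yc; rewrite /dot mxE; apply: eq_bigr => j _; rewrite /brow xc yc !mxE.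
pose inb c (x : X) := branch i ch x == Some c.
exists (fun x => if branch i ch x is Some c then val c :: leaf c x else [::]).
eexists; eexists; split.
(* The node contributes X with sign plus and Y with sign minus; each child's catalyst is restricted
   to the inputs entering that child. This fixes [kap] and [cost]. *)
- apply: catalystD (catalystD (catalyst_query b0 i (brow P)) (catalyst_queryN b0 i (brow Q))).
  apply: (catalyst_sum (index_enum 'I_(size ch))
    (kap := fun c x y => (inb c x && inb c y)%:R * kap c x y)
    (cost := fun c x => (inb c x)%:R * cost c x)) => c.
  by case: (IH c) => kc _ _ _; apply: catalyst_restrict.
- move=> x y; rewrite !dt_eval_Node.
  case: (branch i ch x) => // c; case: (branch i ch y) => // c' okx oky [] /val_inj cc'.
  by case: _ / cc' oky => oky; case: (IH c) => _ + _ _; apply.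
- move=> x y; rewrite !dt_eval_Node; case xc: (branch i ch x) => [c|] //.
  case yc: (branch i ch y) => [c'|] // okx oky /=.
  rewrite (branch_eq xc yc) eqseq_cons !(dot_brow _ _ _ _ _ xc yc) -PE -QE.
  rewrite (bigD1 c) //= big1 => [|c2 c2c]; last first.
    by rewrite /inb xc /= (inj_eq Some_inj) eq_sym (negPf c2c) mul0r.
  rewrite addr0 -mulrBr /inb xc yc !(inj_eq Some_inj) eqxx /= (eq_sym c').
  (* In a common child the terms of this node vanish and induction applies; otherwise the children's
     terms vanish and X - Y = 1 remains. *)
  have [ecc|ncc] := eqVneq c c'.
    case: _ / ecc oky {yc} => oky; rewrite eqxx mul1r mul0r addr0 /=.
    by case: (IH c) => _ _ + _; apply.
  by rewrite (inj_eq val_inj) (negPf ncc) /= mul0r add0r mul1r AB.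
- move=> x; rewrite !dt_eval_Node; case xc: (branch i ch x) => [c|] // okx.
  rewrite !(dot_brow _ _ _ _ _ xc xc) -PE -QE (bigD1 c) //= big1 => [|c2 c2c]; last first.
    by rewrite /inb xc /= (inj_eq Some_inj) eq_sym (negPf c2c) mul0r.
  rewrite addr0 /inb xc eqxx mul1r.
  have -> : (w [::])%:C%C = (w [:: val c])%:C%C + (w [::] - w [:: val c])%:C%C.
    by rewrite -rmorphD /= addrC subrK.
  by rewrite lerD //; case: (IH c) => _ _ _; apply.
Qed.

End TreeCatalyst.

(** * From a catalyst to a quantum query algorithm *)

Section QueryAlgorithm.
Local Open Scope sesquilinear_scope.
Variables (n : nat) (SI : finType).
Local Notation X := {ffun 'I_n -> SI}.
Local Notation A := ('I_n * 'I_#|SI|)%type.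

Section Encoding.
Variable Z : finType.
Local Notation Q := (qdim n #|SI| #|Z|).

Definition decode (s : 'I_Q) : A * Z := ((enum_val s).1, enum_val (enum_val s).2).
Definition encode (p : A * Z) : 'I_Q := enum_rank (p.1, enum_rank p.2).

Lemma decodeK : cancel decode encode.
Proof. by move=> s; rewrite /decode /encode /= enum_valK -surjective_pairing enum_valK. Qed.

Lemma encodeK : cancel encode decode.
Proof. by move=> [p z]; rewrite /decode /encode enum_rankK /= enum_rankK. Qed.

Lemma sum_decode (F : A * Z -> Cplx) : \sum_s F (decode s) = \sum_p F p.
Proof.
rewrite [RHS](reindex decode) //; apply: onW_bij.
exact: Bijective decodeK encodeK.
Qed.

Definition rowof (F : A * Z -> Cplx) : 'rV[Cplx]_Q := \row_s F (decode s).

Lemma rowof_dot F G : rowof F *m (rowof G) ^t* = (dot F G)%:M.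
Proof.
rewrite [LHS]mx11_scalar mxE; congr (_%:M); rewrite -[RHS]sum_decode.
by apply: eq_bigr => s _; rewrite !mxE.
Qed.

Lemma oracle_decode (x : X) (s t : 'I_Q) :
  (oracle_step x (enum_val s) == enum_val t) = (query x (decode s) == decode t).
Proof.
rewrite /decode /query; case: (enum_val s) => [[i b] z]; case: (enum_val t) => [[j c] z'] /=.
by rewrite !xpair_eqE (inj_eq enum_val_inj).
Qed.

Lemma rowof_oracle (x : X) F G : F =1 G \o query x -> rowof F *m oracle #|Z| x = rowof G.
Proof.
move=> FG; apply/rowP => t; rewrite !mxE.
pose H (p : A * Z) := G (query x p) * (query x p == decode t)%:R.
rewrite (eq_bigr (fun s => H (decode s))) => [|s _]; last first.
  by rewrite !mxE oracle_decode FG.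
rewrite sum_decode /H -(reindex_inj (@query_inj _ _ _ x) (P := xpredT)
  (F := fun p => G p * (p == decode t)%:R)) /=.
by rewrite (bigD1 (decode t)) //= eqxx mulr1 big1 ?addr0 // => p /negPf->; rewrite mulr0.
Qed.

End Encoding.

Lemma row_sqr_norm q (p : 'rV[Cplx]_q) : \sum_s `|p 0 s| ^+ 2 = (p *m p ^t*) 0 0.
Proof. by rewrite mxE; apply: eq_bigr => s _; rewrite normCK !mxE. Qed.

Lemma unitary_sqr_norm q (p : 'rV[Cplx]_q) (M : 'M_q) : M \is unitarymx ->
  \sum_s `|(p *m M) 0 s| ^+ 2 = \sum_s `|p 0 s| ^+ 2.
Proof. by move=> Mu; rewrite !row_sqr_norm trmx_mul map_mxM mulmxA mulmxtVK. Qed.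

Lemma oracle_unitary k (x : X) : oracle k x \is unitarymx.
Proof.
apply/unitarymxP/matrixP => s t; rewrite !mxE.
have stepI : injective (@oracle_step n SI k x).
  move=> [[i b] z] [[i' b'] z'] [<- eb <-].
  by have -> : b = b' by apply: (@addI_inj _ (enum_rank (x i))); apply: val_inj.
rewrite (bigD1 (enum_rank (oracle_step x (enum_val s)))) //= big1 => [|r rs].
  rewrite !mxE enum_rankK eqxx mul1r addr0 rmorph_nat.
  by rewrite (inj_eq stepI) (inj_eq enum_val_inj) eq_sym.
rewrite !mxE; case: eqP => [er|_]; last by rewrite mul0r.
by move: rs; rewrite er enum_valK eqxx.
Qed.

(** For a fixed input the run is linear in the initial state, so the runs with and without the
    catalyst can be subtracted. *)
Lemma qrun_unitary k (x : X) (U : nat -> 'M[Cplx]_(qdim n #|SI| k)) j :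
    (forall i, U i \is unitarymx) ->
  exists2 M, M \is unitarymx & forall p, qrun x p U j = p *m M.
Proof.
move=> Uu; elim: j => [|j [M Mu ME]]; first by exists (U 0%N).
exists (M *m oracle k x *m U j.+1) => [|p]; last by rewrite /= ME !mulmxA.
by rewrite !mul_unitarymx ?oracle_unitary.
Qed.

Variables (SO : finType) (D : {set X}) (f : X -> SO).
Variables (L : eqType) (leaf : X -> L) (kap : X -> X -> Cplx) (cost : X -> Cplx).
Hypothesis kap_cat : catalyst kap cost.
Hypothesis leaf_f : {in D &, forall x y, leaf x = leaf y -> f x = f y}.
Hypothesis kap_leaf : {in D &, forall x y, kap x y = (leaf x != leaf y)%:R}.

(* Each of the N registers is turned from |xi> into |leaf x> by one query with the
   help of the catalyst, which is returned unchanged. Running the same unitaries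
   without supplying the catalyst moves the state by at most 2 |v_x| / sqrt N. *)
Lemma catalyst_algorithm (x0 : X) (i0 : 'I_n) (W : Cplx) (N : nat) : (0 < N)%N ->
  {in D, forall x, cost x <= W} -> 12%:R * W <= N%:R ->
  exists k, qcomputes_bounded D f k N.
Proof.
move=> N_gt0 costW WN; have [Z0 [v [u [vu vuk vcost]]]] := kap_cat.
pose Z : finType := (Z0 + 'I_N * {set X})%type.
exists #|Z|.
pose cls x : {set X} := [set y | leaf y == leaf x].
have cls_eq x y : (cls x == cls y) = (leaf x == leaf y).
  apply/eqP/eqP => [/setP/(_ x)|exy]; first by rewrite !inE eqxx => /esym/eqP.
  by apply/setP => z; rewrite !inE exy.
(* The N registers are tensored with the uniform superposition over the query register, which every
   oracle leaves invariant. *)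
pose h : Cplx := (sqrtC #|{: A}|%:R)^-1.
have A_neq0 : #|{: A}|%:R != 0 :> Cplx.
  by rewrite pnatr_eq0 -lt0n; apply/card_gt0P; exists (i0, enum_rank (x0 i0)).
have hh : dot (fun _ : A => h) (fun _ : A => h) = 1.
  rewrite /dot sumr_const -normCK normfV exprVn ger0_norm ?sqrtC_ge0 ?ler0n //.
  by rewrite sqrtCK -[LHS]mulr_natl divff.
pose reg j x (r : 'I_N * {set X}) : Cplx :=
  (r.2 == if (r.1 < j)%N then cls x else finset.set0)%:R.
have dot_reg j x y :
    dot (reg j x) (reg j y) = \sum_(t < N) (if (t < j)%N then (leaf x == leaf y)%:R else 1).
  rewrite /dot -(pair_bigA _ (fun t S => reg j x (t, S) * (reg j y (t, S))^*)) /=.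
  apply: eq_bigr => t _; rewrite /reg /=.
  by case: ifP => _; rewrite -[LHS]/(dot _ _) dot_delta ?cls_eq ?eqxx.
(* Unnormalized state: the catalyst next to N registers of norm 1, the first j of them holding the
   leaf. *)
pose st (w : X -> A * Z0 -> Cplx) j x (s : A * Z) : Cplx :=
  match s.2 with inl z => w x (s.1, z) | inr r => h * reg j x r end.
have dot_st w j x y : dot (st w j x) (st w j y) = dot (w x) (w y) + dot (reg j x) (reg j y).
  rewrite dot_sum; congr (_ + _); first by apply: eq_dot => -[].
  by rewrite (dot_tensor (fun=> h) (fun=> h)) hh mul1r.
have st_query j x : st v j x =1 st u j x \o query x.
  by move=> [p [z|r]] //; rewrite /st /= vu.
(* Only register j changes. Its inner product drops from 1 to [leaf x = leaf y], and [kap] is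
   exactly this drop. *)
have st_gram j x y : (j < N)%N -> x \in D -> y \in D ->
    dot (st u j x) (st u j y) = dot (st v j.+1 x) (st v j.+1 y).
  move=> jN xD yD; rewrite !dot_st !dot_reg.
  have := vuk x y; rewrite kap_leaf // => /(canRL (subrK _)) ->.
  rewrite !(bigD1 (Ordinal jN) (P := xpredT)) //= ltnn ltnSn.
  rewrite [X in _ = _ + (_ + X)](eq_bigr
    (fun t : 'I_N => if (t < j)%N then (leaf x == leaf y)%:R else 1)) => [|t tj].
    by case: (leaf x == leaf y); rewrite ?addr0 ?add0r // [1 + dot _ _]addrC -addrA ?add0r.
  by rewrite ltnS leq_eqVlt (negPf (tj : t != j :> nat)).
have /choice[V VP] : forall j, exists V : 'M[Cplx]_(qdim n #|SI| #|Z|),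
    V \is unitarymx /\ ((j < N)%N ->
      {in D, forall x, rowof (st u j x) *m V = rowof (st v j.+1 x)}).
  move=> j; case: (boolP (j < N)%N) => jN; last by exists 1%:M; rewrite unitarymx1.
  have [|V Vu VE] := @unitary_of_gram _ _ X (enum D)
      (fun x => rowof (st u j x)) (fun x => rowof (st v j.+1 x)).
    by move=> x y; rewrite !mem_enum => xD yD; rewrite !rowof_dot st_gram.
  by exists V; split=> // _ x xD; rewrite VE ?mem_enum.
(* The first query comes after [U 0], so [V j] follows query number j + 1. *)
pose U j := if j is j'.+1 then V j' else 1%:M.
have Uu j : U j \is unitarymx by case: j => [|j]; [rewrite unitarymx1 | case: (VP j)].
have run_st x j : x \in D -> (j <= N)%N -> qrun x (rowof (st v 0%N x)) U j = rowof (st v j x).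
  move=> xD; elim: j => [|j IHj] jN; first by rewrite /= mulmx1.
  by rewrite /= IHj ?(ltnW jN) // (rowof_oracle (st_query j x)); case: (VP j) => _ ->.
pose c : Cplx := (sqrtC N%:R)^-1.
have N_neq0 : N%:R != 0 :> Cplx by rewrite pnatr_eq0 -lt0n.
have c2 : `|c| ^+ 2 = N%:R^-1.
  by rewrite normfV exprVn ger0_norm ?sqrtC_ge0 ?ler0n // sqrtCK.
pose vonly x (s : A * Z) : Cplx := if s.2 is inl z then v x (s.1, z) else 0.
pose start (s : A * Z) : Cplx := if s.2 is inr r then h * (r.2 == finset.set0)%:R else 0.
have startE x : rowof start = rowof (st v 0%N x) - rowof (vonly x).
  apply/rowP => s; rewrite !mxE /start /st /vonly.
  by case: (decode s).2 => [z|r]; rewrite ?subrr ?subr0.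
have start_norm : \sum_s `|(c *: rowof start) 0 s| ^+ 2 = 1.
  rewrite (eq_bigr (fun s => N%:R^-1 * `|rowof start 0 s| ^+ 2)) => [|s _]; last first.
    by rewrite mxE normrM exprMn c2.
  rewrite -mulr_sumr row_sqr_norm rowof_dot mxE mulr1n.
  have -> : dot start start = dot (st (fun _ _ => 0) 0%N x0) (st (fun _ _ => 0) 0%N x0).
    by apply: eq_dot => -[p [z|r]].
  rewrite dot_st dot_reg /= sumr_const card_ord [X in X + _]big1 ?add0r ?mulVf //.
  by move=> s _; rewrite mul0r.
have vonly_norm x : \sum_s `|rowof (vonly x) 0 s| ^+ 2 = cost x.
  rewrite row_sqr_norm rowof_dot mxE mulr1n -vcost dot_sum [X in _ + X]big1 ?addr0.
    by apply: eq_dot => -[].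
  by move=> s _; rewrite mul0r.
(* On reading a set of inputs, answer with the value of f at any of its members in D; [f x0] is a
   default. *)
pose outZ (z : Z) : SO :=
  if z is inr r then (if [pick y in D | y \in r.2] is Some y then f y else f x0) else f x0.
exists (c *: rowof start), U, (fun s => outZ (decode s).2); split=> // x xD.
have [M Mu ME] := qrun_unitary x N Uu.
pose fin := qrun x (c *: rowof start) U N.
have fin_norm : \sum_s `|fin 0 s| ^+ 2 = 1 by rewrite /fin ME unitary_sqr_norm.
have finE : fin = c *: (rowof (st v N x) - rowof (vonly x) *m M).
  by rewrite /fin ME (startE x) -scalemxAl mulmxBl -(ME (rowof (st v 0%N x))) run_st.
(* At a wrong outcome the ideal final state has only its catalyst part: a register entry is nonzero
   only at [cls x], where the answer is right. What remains is the error due to the missing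
   catalyst. *)
have fail s : outZ (decode s).2 != f x ->
    `|fin 0 s| ^+ 2 <=
    N%:R^-1 * ((`|rowof (vonly x) 0 s| ^+ 2 + `|(rowof (vonly x) *m M) 0 s| ^+ 2) *+ 2).
  move=> out_s; rewrite finE mxE normrM exprMn c2 ler_wpM2l ?invr_ge0 ?ler0n //.
  rewrite [X in `|X|]mxE [X in _ + X]mxE.
  suff -> : rowof (st v N x) 0 s = rowof (vonly x) 0 s by apply: sqr_norm_sub_le.
  rewrite !mxE /st /vonly; case: (decode s).2 out_s => //= -[t S] /= out_s.
  rewrite /reg /= ltn_ord; case: (S =P cls x) out_s => [->|]; last by rewrite mulr0.
  case: pickP => [y /andP[yD]|/(_ x)]; last by rewrite xD inE eqxx.
  by rewrite inE => /eqP yx; rewrite (leaf_f yD xD yx) eqxx.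
have W_ge0 : 0 <= cost x by rewrite -vcost dotxx_ge0.
rewrite -/fin; move: fin_norm; rewrite (bigID (fun s => outZ (decode s).2 == f x)) /=.
move=> /(canRL (addrK _)) ->.
have -> : 2%:R / 3%:R = 1 - 1 / 3%:R :> Cplx by field.
rewrite lerD2l lerN2; apply: le_trans (ler_sum _ fail) _.
rewrite -mulr_sumr sumrMnl -ler_pdivlMl ?invr_gt0 ?ltr0n // invrK.
(* Total failure is at most 4 cost / N, hence at most 1/3 as N is at least 12 W. *)
apply: (@le_trans _ _ ((cost x + cost x) *+ 2)); last first.
  rewrite mulrA mulr1 ler_pdivlMr ?ltr0n // (le_trans _ WN) //.
  have -> : (cost x + cost x) *+ 2 * 3%:R = 12%:R * cost x by ring.
  by rewrite ler_wpM2l ?ler0n ?costW.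
rewrite lerMn2r /= -{1}(vonly_norm x) -(vonly_norm x) -{2}(unitary_sqr_norm _ Mu) -big_split /=.
rewrite big_mkcond /=; apply: ler_sum => s _; case: ifP => // _.
by rewrite addr_ge0 ?exprn_ge0.
Qed.

End QueryAlgorithm.

(** * Existence of weighting schemes and of computing trees *)

Section Existence.
Variables (n : nat) (SI SO : finType).
Local Notation X := {ffun 'I_n -> SI}.

(** With X all ones and Y = 0, a node only has to exceed each child by 1. It shows that the infimum
    in [WDT_tree] is over an inhabited set. *)
Lemma wscheme_exists (t : dtree n SI SO) : dt_wf t -> exists w, is_wscheme t w.
Proof.
elim=> {t} [o|i ch _ _ /choice[ws wsP]].
  by exists (fun=> 0); apply: ws_leaf.
have ws_ge0 c := wscheme_ge0 (wsP c).
pose w (p : seq nat) : Rdefinitions.R :=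
  if p is j :: p' then (if insub j is Some c then ws c p' else 0)
  else 1 + \sum_c ws c [::].
have wE c : (fun p => w (val c :: p)) = ws c by apply/funext => p; rewrite /w valK.
exists w; apply: ws_node => [||c]; last by rewrite wE.
  by rewrite /w addr_ge0 ?sumr_ge0.
exists (const_mx 1), 0; split=> [||c1 c2 _|c].
- exact: psdmx_const1.
- exact: psdmx0.
- by rewrite !mxE subr0.
rewrite !mxE addr0 -[X in w [:: X]]/(val c) -(rmorph1 (real_complex _)) lecR.
rewrite -[w [:: val c]]/((fun p => w (val c :: p)) [::]) wE /w (bigD1 c) //=.
by rewrite addrA addrAC addrK lerDl sumr_ge0.
Qed.

Lemma dt_eval_Node_map (i : 'I_n) (g : SI -> dtree n SI SO) (s : seq SI) (x : X) :
  dt_eval (Node i [seq (a, g a) | a <- s]) x =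
  if x i \in s then dt_eval (g (x i)) x else None.
Proof.
by rewrite /=; elim: s => //= a s IHs; rewrite inE eq_sym; case: eqVneq => //= ->.
Qed.

Lemma dt_wf_Node_map (i : 'I_n) (g : SI -> dtree n SI SO) (s : seq SI) :
  uniq s -> (forall a, dt_wf (g a)) -> dt_wf (Node i [seq (a, g a) | a <- s]).
Proof.
move=> s_uniq g_wf; apply: wf_node; first by rewrite -map_comp map_id.
move=> c; rewrite /child; set d := tnth _ _.
have cs : (c < size s)%N by have := ltn_ord c; rewrite [X in (_ < X)%N -> _]size_map.
by rewrite /d (tnth_nth d) /= (nth_map d.1) //=; apply: g_wf.
Qed.

(** Queries the indices in [l] one after another and records the answers in [y]. *)
Fixpoint full_tree (f : X -> SO) (l : seq 'I_n) (y : X) : dtree n SI SO :=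
  if l is i :: l'
  then Node i [seq (a, full_tree f l' [ffun j => if j == i then a else y j]) | a <- enum SI]
  else Leaf (f y).

Lemma full_tree_wf f l y : dt_wf (full_tree f l y).
Proof.
elim: l y => [|i l IHl] y; first exact: wf_leaf.
by apply: dt_wf_Node_map => [|a]; rewrite ?enum_uniq.
Qed.

Lemma full_tree_eval f l y x :
  dt_eval (full_tree f l y) x = Some (f [ffun j => if j \in l then x j else y j]).
Proof.
elim: l y => [|i l IHl] y.
  by congr (Some (f _)); apply/ffunP => j; rewrite ffunE.
rewrite [full_tree _ _ _]/= dt_eval_Node_map mem_enum IHl /=.
congr (Some (f _)); apply/ffunP => j; rewrite !ffunE inE.
by case: (eqVneq j i) => [->|] //=; rewrite if_same.
Qed.

Lemma full_tree_computes f D y : dt_computes (full_tree f (enum 'I_n) y) D f.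
Proof.
move=> x _; rewrite full_tree_eval; congr (Some (f _)).
by apply/ffunP => j; rewrite ffunE mem_enum.
Qed.

End Existence.

(** * Lower bound on the cost, and the final query count *)

Lemma catalyst_cost_ge n (SI : finType) (C : numClosedFieldType)
    (kap : {ffun 'I_n -> SI} -> {ffun 'I_n -> SI} -> C) cost x y :
  catalyst kap cost -> `|kap x y + kap y x| <= (cost x + cost y) *+ 2.
Proof.
move=> [Z [v [u [vu k c]]]]; rewrite -!k -!c.
(* The query permutes basis states, so v_z and its image u_z have the same norm. *)
have vv z : dot (v z) (v z) = dot (u z) (u z).
  by rewrite -(dot_reindex (u z) (u z) (@query_inj _ _ _ z)); apply: eq_dot.
rewrite addrACA -opprD mulr2n (le_trans (ler_normB _ _)) // lerD ?re_dot_le //.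
by rewrite !vv re_dot_le.
Qed.

Lemma qcomputes_const n (SI SO : finType) (D : {set {ffun 'I_n -> SI}})
    (f : {ffun 'I_n -> SI} -> SO) (i0 : 'I_n) (b0 : 'I_#|SI|) (o : SO) :
  {in D, forall x, f x = o} -> qcomputes_bounded D f 1 0.
Proof.
move=> fo; pose s0 : 'I_(qdim n #|SI| 1) := enum_rank (i0, b0, ord0).
have norm1 : \sum_s `|(delta_mx 0 s0 : 'rV[Cplx]_(qdim n #|SI| 1)) 0 s| ^+ 2 = 1.
  rewrite (bigD1 s0) //= !mxE !eqxx normr1 expr1n big1 ?addr0 // => s /negPf s0s.
  by rewrite !mxE s0s andbF normr0 expr0n.
exists (delta_mx 0 s0), (fun=> 1%:M), (fun=> o); split=> // [j _|x xD].
  exact: unitarymx1.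
by rewrite fo // eqxx /= mulmx1 norm1 ler_pdivrMr ?ltr0n // mul1r ler_nat.
Qed.

Lemma wscheme_algorithm n (SI SO : finType) (D : {set {ffun 'I_n -> SI}})
    (f : {ffun 'I_n -> SI} -> SO) (t : dtree n SI SO) (w : seq nat -> Rdefinitions.R) :
  (0 < n)%N -> (0 < #|SI|)%N -> dt_computes t D f -> is_wscheme t w ->
  exists k T : nat, qcomputes_bounded D f k T /\ (T%:R : Rdefinitions.R) <= 14%:R * w [::].
Proof.
move=> n_gt0 SI_gt0 tf ws; pose i0 := Ordinal n_gt0; pose b0 := Ordinal SI_gt0.
pose x0 : {ffun 'I_n -> SI} := [ffun=> enum_val b0].
have w_ge0 := wscheme_ge0 ws.
have [leaf [kap [cost [cat leaf_eval kap_leaf costw]]]] := tree_catalyst b0 ws.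
have ok x : x \in D -> dt_eval t x by move=> xD; rewrite tf.
have leaf_f : {in D &, forall x y, leaf x = leaf y -> f x = f y}.
  by move=> x y xD yD /(leaf_eval _ _ (ok x xD) (ok y yD)); rewrite !tf // => -[].
(* A constant f is split off because w_r may then be 0, while rounding up costs a query. *)
have [/existsP[o /forall_inP fo]|/existsPn fN] :=
    boolP [exists o, [forall (x | x \in D), f x == o]].
  exists 1, 0; split; last by rewrite mulr_ge0 ?ler0n.
  by apply: (qcomputes_const i0 b0 (o := o)) => x xD; apply/eqP/fo.
(* Two inputs with different values reach different leaves, so [kap] is 1 in both orders and the
   cost bound gives 2 <= 4 w_r. *)
have w_ge : 1 <= 2%:R * w [::].
  have /forall_inPn[x xD _] := fN (f x0).
  have /forall_inPn[y yD fxy] := fN (f x).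
  have leafxy : leaf x != leaf y.
    by apply: contra fxy => /eqP /(leaf_f _ _ xD yD) ->.
  have := catalyst_cost_ge x y cat.
  rewrite !kap_leaf ?ok // leafxy eq_sym leafxy -natrD normr_nat.
  move=> /le_trans /(_ (_ : _ <= ((w [::])%:C%C + (w [::])%:C%C) *+ 2)).
  rewrite lerMn2r /= lerD ?costw ?ok // => /(_ isT).
  have -> : ((w [::])%:C%C + (w [::])%:C%C) *+ 2 = ((w [::] + w [::]) *+ 2)%:C%C :> Cplx.
    by rewrite rmorphMn rmorphD.
  have -> : (1 + 1)%:R = (2%:R : Rdefinitions.R)%:C%C :> Cplx by rewrite rmorph_nat.
  rewrite lecR.
  by move: (w [::]) => r; lra.
(* N exceeds 12 w_r by at most 1, and 1 <= 2 w_r, whence the constant 14. *)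
pose N := (Num.truncn (12%:R * w [::])).+1.
have w12_ge0 : 0 <= 12%:R * w [::] by rewrite mulr_ge0 ?ler0n.
have /andP[Nle ltN] := truncn_itv w12_ge0.
have [|k kP] := @catalyst_algorithm _ _ _ D f _ leaf kap cost cat leaf_f
    (fun x y xD yD => kap_leaf x y (ok x xD) (ok y yD)) x0 i0 (w [::])%:C%C N isT
    (fun x xD => costw x (ok x xD)).
  rewrite -(rmorph_nat (real_complex _) N) -(rmorph_nat (real_complex _) 12) -rmorphM.
  by rewrite lecR ltW.
exists k, N; split=> //; rewrite /N -natr1.
by move: (w [::]) (Num.truncn _)%:R w_ge Nle => r m; lra.
Qed.

Theorem theorem6p2 :
  exists K : Rdefinitions.R, 0 < K /\
  forall (n : nat) (SI SO : finType) (D : {set {ffun 'I_n -> SI}})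
         (f : {ffun 'I_n -> SI} -> SO),
    (0 < n)%N -> (0 < #|SI|)%N ->
    (forall (t : dtree n SI SO) (w : seq nat -> Rdefinitions.R),
        dt_wf t -> dt_computes t D f -> is_wscheme t w ->
        exists k T : nat, qcomputes_bounded D f k T /\ (T%:R : Rdefinitions.R) <= K * w [::])
    /\ Qcomplexity D f <= K * WDT D f.
Proof.
exists 14%:R; split=> [|n SI SO D f n_gt0 SI_gt0]; first by rewrite ltr0n.
have algP t w := @wscheme_algorithm n SI SO D f t w n_gt0 SI_gt0.
split=> [t w _ tf ws|]; first exact: algP tf ws.
pose x0 : {ffun 'I_n -> SI} := [ffun=> enum_val (Ordinal SI_gt0)].
(* Dividing by 14 makes the claim a lower bound on an infimum, checked first over trees and then
   over weighting schemes; both sets must be shown inhabited. *)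
rewrite mulrC -ler_pdivrMr ?ltr0n //; apply: lb_le_inf => [|_ [t [t_wf tf] <-]].
  exists (WDT_tree (full_tree f (enum 'I_n) x0)).
  exists (full_tree f (enum 'I_n) x0) => //.
  by split; [apply: full_tree_wf | apply: full_tree_computes].
apply: lb_le_inf => [|_ [w ws <-]].
  by have [w ws] := wscheme_exists t_wf; exists (w [::]), w.
rewrite ler_pdivrMr ?ltr0n // mulrC.
have [k [T [kT]]] := algP _ _ tf ws; apply: le_trans.
by apply: ge_inf; [exists 0 => _ [T' _ <-]; rewrite ler0n | exists T => //; exists k].
Qed.
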